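(* If $\mathsf{E}\bigl(\sqrt{Y_1}\bigr)=\sum_{k\ge0}\sqrt{k}\,\mu(k)<\infty$, then $$\sum_{k=0}^{\infty}\bigl(1-F_\mu(k)\bigr)^2<\infty .$$
   Context: $Y_1$ is a non-constant random variable with values in $\mathbb{N}_0=\{0,1,2,\dots\}$ and distribution $\mu$; $\mu(k)=\mu(\{k\})$ and $F_\mu(x)=\mu([0,x])$ is the distribution function. *)

(* Defs.v *)
From HB Require Import structures.
From mathcomp Require Import all_boot all_order all_algebra.
From mathcomp Require Import all_classical all_reals all_analysis.

Set Implicit Arguments.
Unset Strict Implicit.
Unset Printing Implicit Defensive.

Import Order.TTheory GRing.Theory Num.Theory.
Import numFieldNormedType.Exports.

Local Open Scope classical_set_scope.
Local Open Scope ring_scope.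
Local Open Scope ereal_scope.

(* The interval [0, x] as a subset of nat; the lower bound is automatic. The
   value is extended-real, as for the library's cdf of a real random variable,
   and is finite because mu is a probability. *)
Definition dist_fun (R : realType) (mu : probability nat R) (x : R) : \bar R :=
  mu [set k : nat | (k%:R <= x)%R].

(* Main.v *)
Require Import Defs.
From HB Require Import structures.
From mathcomp Require Import all_boot all_order all_algebra.
From mathcomp Require Import all_classical all_reals all_analysis.
From mathcomp Require Import measurable_realfun ring.

Set Implicit Arguments.
Unset Strict Implicit.
Unset Printing Implicit Defensive.

Import Order.TTheory GRing.Theory Num.Theory.
Import numFieldNormedType.Exports.

Local Open Scope classical_set_scope.
Local Open Scope ring_scope.
Local Open Scope ereal_scope.

(** Write [p k] for [P (Y > k)], the [k]-th tail, and [a k] for the increment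
    [sqrt (k+1) - sqrt k]. Since [sqrt (Y w)] is the sum of the [a k] with
    [k < Y w], integrating shows that the partial sums of [a k * p k] are at
    most [E (sqrt Y)] ([sum_sqrt_incr_tail_le]). Since [p] decreases, its
    partial sums of squares are at most the squares of these
    ([sum_sqr_le_sqr_sum_sqrt_incr]), so the series in question is at most
    the square of [E (sqrt Y)].

    The final bound [sum of (p k)^2 <= (E (sqrt Y))^2] is the inequality
    [E (min Y Y') <= E (sqrt (Y * Y'))] for an independent copy [Y'] of [Y];
    the partial sums give it without a product space. *)

Definition sqrt_incr (R : rcfType) (k : nat) : R :=
  (Num.sqrt k.+1%:R - Num.sqrt k%:R)%R.

Lemma sqrt_incr_ge0 (R : rcfType) (k : nat) : (0 <= sqrt_incr R k)%R.
Proof. by rewrite subr_ge0 ler_wsqrtr// ler_nat. Qed.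

(** Let [a k] be [sqrt_incr R k] and [S n] the sum of the [a k * p k] with
    [k < n]. As [p] decreases, [S n >= sqrt n * p n] by telescoping, and adding
    the term [a n * p n] gives [S n.+1 >= sqrt n.+1 * p n]. Hence
    [S n.+1 ^ 2 - S n ^ 2 = a n * p n * (S n.+1 + S n)] is at least
    [a n * (sqrt n.+1 + sqrt n) * p n ^ 2], which is [p n ^ 2]. *)
Lemma sum_sqr_le_sqr_sum_sqrt_incr (R : rcfType) (p : nat -> R) (n : nat) :
  (forall k, 0 <= p k)%R -> (forall k, p k.+1 <= p k)%R ->
  (\sum_(k < n) p k ^+ 2 <= (\sum_(k < n) sqrt_incr R k * p k) ^+ 2)%R.
Proof.
move=> p0 p_decr.
have S_ge m : (Num.sqrt m%:R * p m <= \sum_(k < m) sqrt_incr R k * p k)%R.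
  elim: m => [|m IHm]; first by rewrite sqrtr0 mul0r big_ord0.
  rewrite big_ord_recr/=.
  have le_pm : (Num.sqrt m.+1%:R * p m.+1 <= Num.sqrt m.+1%:R * p m)%R.
    by rewrite ler_wpM2l ?sqrtr_ge0.
  by rewrite (le_trans le_pm)// -lerBlDr -mulrBl /sqrt_incr opprB addrC subrK.
elim: n => [|n IHn]; first by rewrite !big_ord0 expr0n.
rewrite !big_ord_recr/=.
move: IHn (S_ge n); set S := (\sum_(k < n) sqrt_incr R k * p k)%R => IHn Sn.
have incr_conj : (sqrt_incr R n * (Num.sqrt n.+1%:R + Num.sqrt n%:R) = 1 :> R)%R.
  by rewrite /sqrt_incr -subr_sqr !sqr_sqrtr ?ler0n// -natrB// subSnn.
have a0 := sqrt_incr_ge0 R n.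
have sqrtS : (Num.sqrt n.+1%:R = sqrt_incr R n + Num.sqrt n%:R :> R)%R.
  by rewrite subrK.
rewrite sqrrD -addrA lerD//.
have -> : (p n ^+ 2 = sqrt_incr R n * p n * (sqrt_incr R n * p n
                      + 2 * (Num.sqrt n%:R * p n)))%R.
  by rewrite -[LHS]mul1r -[in LHS]incr_conj sqrtS; ring.
have -> : (S * (sqrt_incr R n * p n) *+ 2 + (sqrt_incr R n * p n) ^+ 2
           = sqrt_incr R n * p n * (sqrt_incr R n * p n + 2 * S))%R by ring.
by rewrite ler_wpM2l ?mulr_ge0// lerD2l ler_wpM2l.
Qed.

Lemma sum_sqrt_incr_lt (R : rcfType) (n y : nat) :
  (\sum_(k < n) sqrt_incr R k * (k < y)%:R = Num.sqrt (minn n y)%:R)%R.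
Proof.
elim: n => [|n IHn]; first by rewrite big_ord0 min0n sqrtr0.
rewrite big_ord_recr/= IHn; case: ltnP => [lt_ny|le_yn].
  by rewrite mulr1 (minn_idPl lt_ny) addrC subrK.
by rewrite mulr0 addr0 (minn_idPr (leqW le_yn)).
Qed.

Lemma measurable_comp_nat d (T : measurableType d) d' (U : measurableType d')
    (Y : {mfun T >-> nat}) (g : nat -> U) :
  measurable_fun [set: T] (g \o Y).
Proof. exact: measurableT_comp. Qed.

Lemma measurable_tail d (T : measurableType d) (Y : {mfun T >-> nat})
    (k : nat) :
  measurable [set w | (k < Y w)%N].
Proof. exact: (measurable_funPTI Y (Y := [set j | (k < j)%N])). Qed.

(** A truncated layer-cake formula: both sides are integrals, of
    [sqrt (min n (Y w))] and of [sqrt (Y w)]. *)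
Lemma sum_sqrt_incr_tail_le (R : realType) d (T : measurableType d)
    (P : probability T R) (Y : {RV P >-> nat}) (n : nat) :
  \sum_(k < n) (sqrt_incr R k)%:E * P [set w | (k < Y w)%N]
    <= 'E_P[fun w => Num.sqrt ((Y w)%:R : R)].
Proof.
have mtail := measurable_tail Y.
have indic_tail k w : (\1_[set w | (k < Y w)%N] w = (k < Y w)%N%:R :> R)%R.
  rewrite indicE; congr ((nat_of_bool _)%:R)%R.
  by apply/idP/idP; rewrite inE.
have sum_tail : \sum_(k < n) (sqrt_incr R k)%:E * P [set w | (k < Y w)%N] =
    \int[P]_w \sum_(k < n) ((sqrt_incr R k)%:E * (\1_[set w | (k < Y w)%N] w)%:E).
  rewrite ge0_integral_sum//.
  - apply: eq_bigr => k _; rewrite ge0_integralZl_EFin ?sqrt_incr_ge0//.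
    + by rewrite integral_indic// setIT.
    + by apply/measurable_EFinP; exact: measurable_indic.
  - move=> k; apply: measurable_funeM.
    by apply/measurable_EFinP; exact: measurable_indic.
  - by move=> k w _; rewrite mule_ge0// lee_fin sqrt_incr_ge0.
have sum_point w :
    \sum_(k < n) ((sqrt_incr R k)%:E * (\1_[set w | (k < Y w)%N] w)%:E) =
    (Num.sqrt (minn n (Y w))%:R)%:E.
  rewrite -sum_sqrt_incr_lt -sumEFin.
  by apply: eq_bigr => k _; rewrite indic_tail EFinM.
rewrite sum_tail [in leRHS]unlock; under eq_integral do rewrite sum_point.
apply: ge0_le_integral => //.
- exact: (measurable_comp_nat Y (fun y => (Num.sqrt (minn n y)%:R)%:E)).
- exact: (measurable_comp_nat Y (fun y => (Num.sqrt y%:R)%:E)).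
- by move=> w _; rewrite lee_fin ler_wsqrtr// ler_nat geq_minr.
Qed.

Lemma compl_dist_funE (R : realType) d (T : measurableType d)
    (P : probability T R) (Y : {RV P >-> nat}) (k : nat) :
  1 - dist_fun (distribution P Y) k%:R = P [set w | (k < Y w)%N].
Proof.
rewrite /dist_fun -probability_setC//; congr (P _).
by apply/seteqP; split => w /=; rewrite ler_nat ltnNge => /negP.
Qed.

Theorem mainTheorem12 (R : realType) (d : measure_display)
  (T : measurableType d) (P : probability T R) (Y : {RV P >-> nat})
  (Y_nonconst : ~ exists c : nat, {ae P, forall w, Y w = c})
  (E_sqrt_lty : 'E_P[fun w => Num.sqrt ((Y w)%:R : R)] < +oo) :
  \sum_(0 <= k <oo) (1 - dist_fun (distribution P Y) k%:R) ^+ 2 < +oo.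
Proof.
pose E := 'E_P[fun w => Num.sqrt ((Y w)%:R : R)].
pose p k := fine (P [set w | (k < Y w)%N]).
have mtail := measurable_tail Y.
have pE k : P [set w | (k < Y w)%N] = (p k)%:E.
  by rewrite fineK// fin_num_measure.
have p0 k : (0 <= p k)%R by exact: fine_ge0.
have p_decr k : (p k.+1 <= p k)%R.
  by rewrite -lee_fin -!pE le_measure ?inE// => w; exact: ltnW.
have E0 : 0 <= E.
  by rewrite /E unlock integral_ge0// => w _; rewrite lee_fin sqrtr_ge0.
have EE : E = (fine E)%:E by rewrite fineK// ge0_fin_numE.
under eq_eseriesr do rewrite compl_dist_funE pE -EFin_expe.
apply: (@le_lt_trans _ _ ((fine E) ^+ 2)%:E); last exact: ltry.
apply: lime_le; first by apply: is_cvg_nneseries => k _ _; rewrite lee_fin sqr_ge0.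
apply: nearW => n; rewrite sumEFin lee_fin big_mkord.
apply: (le_trans (sum_sqr_le_sqr_sum_sqrt_incr n p0 p_decr)).
rewrite ler_sqr ?nnegrE ?fine_ge0//; last first.
  by apply: sumr_ge0 => k _; rewrite mulr_ge0 ?sqrt_incr_ge0.
rewrite -lee_fin -EE -sumEFin; apply: le_trans (sum_sqrt_incr_tail_le Y n).
by apply: lee_sum => k _; rewrite pE EFinM.
Qed.
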